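(* Let $G$ be a simple connected graph with $n$ nodes and $m$ edges, let $q$ be a positive integer, and let $R_q(G)$ be its $q$-triangulation graph. Then the multiplicative degree-Kirchhoff index satisfies $$\hat{\mathcal K}(R_q(G))=\frac{2(2q+1)^2}{q+2}\hat{\mathcal K}(G)+2m\left(\frac{q^2+(4n-1)q+2n}{q+2}+(mq-n)(2q+1)\right).$$
   Context: For a positive integer $q$, the $q$-triangulation graph $R_q(G)$ is obtained from $G$ by keeping all nodes and edges of $G$ and adding, for each edge $uv$ of $G$, $q$ disjoint paths of length $2$: $ux_1v,\dots,ux_qv$, where $x_1,\dots,x_q$ are new nodes. The resistance distance $r_{ij}$ between nodes $i,j$ of a simple connected graph is the effective resistance between them when every edge is replaced by a unit resistor. With $d_i$ the degree of node $i$, the multiplicative degree-Kirchhoff index is $\hat{\mathcal K}(G)=\sum_{\{i,j\}\subseteq V(G)}d_id_jr_{ij}=\frac12\sum_{i,j}d_id_jr_{ij}$. *)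

(* Defs.v *)
From HB Require Import structures.
From mathcomp Require Import all_boot all_order all_algebra.
From mathcomp Require Import boolp classical_sets.

Set Implicit Arguments.
Unset Strict Implicit.
Unset Printing Implicit Defensive.

Import Order.TTheory GRing.Theory Num.Theory.

Record sgraph := SGraph {
  vertex :> finType;
  adj : rel vertex;
  adj_sym : symmetric adj;
  adj_irrefl : irreflexive adj }.

Definition connected_graph (G : sgraph) : Prop :=
  forall x y : G, connect (@adj G) x y.

Definition edges (G : sgraph) : {set {set G}} :=
  [set A : {set G} | [exists x, exists y, adj x y && (A == [set x; y])]]%SET.

Definition degree (G : sgraph) (x : G) : nat := #|[set y | adj x y]%SET|.

Section Triangulation.
Variables (q : nat) (G : sgraph).

(* [inr (uv, k)] is the middle node of the [k]-th path added for the edge [uv]. *)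
Definition tri_vertex : finType := (G + {A : {set G} | A \in edges G} * 'I_q)%type.

Definition tri_adj (a b : tri_vertex) : bool :=
  match a, b with
  | inl u, inl v => adj u v
  | inl u, inr (uv, _) => u \in val uv
  | inr (uv, _), inl u => u \in val uv
  | inr _, inr _ => false
  end.

Lemma tri_adj_sym : symmetric tri_adj.
Proof. by move=> [u|[A k]] [v|[B l]] //=; rewrite adj_sym. Qed.

Lemma tri_adj_irrefl : irreflexive tri_adj.
Proof. by move=> [u|[A k]] //=; rewrite adj_irrefl. Qed.

Definition triangulation : sgraph := SGraph tri_adj_sym tri_adj_irrefl.

End Triangulation.

Local Open Scope ring_scope.

(* Kirchhoff's current law with Ohm's law on unit resistors: [v] is a node
   potential when a unit current enters at [i] and leaves at [j]. *)
Definition unit_current_potential (R : realFieldType) (G : sgraph) (i j : G)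
    (v : G -> R) : Prop :=
  forall x : G,
    \sum_(y | adj x y) (v x - v y) = (x == i)%:R - (x == j)%:R.

(* The potential drop is the same for every such [v] when [G] is connected;
   the default value 0 is used only if there is no such [v]. *)
Definition resistance (R : realFieldType) (G : sgraph) (i j : G) : R :=
  xget 0 [set v i - v j | v in [set v | unit_current_potential i j v]]%classic.

Definition mult_degree_kirchhoff (R : realFieldType) (G : sgraph) : R :=
  2^-1 * \sum_(i : G) \sum_(j : G)
           (degree i)%:R * (degree j)%:R * resistance R i j.

(* Main.v *)
Require Import Defs.
From HB Require Import structures.
From mathcomp Require Import all_boot all_order all_algebra.
From mathcomp Require Import boolp classical_sets.
From mathcomp Require Import ring.

Set Implicit Arguments.
Unset Strict Implicit.
Unset Printing Implicit Defensive.

Import Order.TTheory GRing.Theory Num.Theory.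
Local Open Scope ring_scope.

(** Resistances are differences of a Green kernel [g]: a symmetric function
    such that [g^~ j] is the potential of a unit current entering at [j] and
    leaving with a density [mu] that does not depend on [j]. Superposing [g^~ i]
    and [- g^~ j] cancels [mu], so the resistance between [i] and [j] is
    [g i i + g j j - 2 * g i j] ([resistance_green]). With [d] the degree,
    the index of [G] is therefore [D * T - Q], where [D] is the sum of the
    [d x], [T] the sum of the [d x * g x x] and [Q] the sum of the
    [d x * d y * g x y] ([mult_degree_kirchhoff_green]).

    A Green kernel of [G] yields one of the triangulation
    ([triangulation_greenP]). Eliminating the [q] middle nodes of an edge
    multiplies its conductance by [1 + q / 2], and a middle node that receives
    no current has the mean of the potentials at its two neighbours. Hence with
    [E] the operator that keeps the value at old nodes and takes the mean of the
    two endpoints at middle nodes, the new kernel is [2 / (q + 2)] times [g] with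
    [E] applied in both arguments, plus [1 / 2] on the diagonal at middle nodes,
    the resistance from such a node to its two neighbours held together.

    Degrees are multiplied by [q + 1] at old nodes and are 2 at middle nodes, so
    the degree-weighted sum of [E h] is [2 * q + 1] times that of [h]
    ([sum_degree_mean]). This gives the new [D] and [Q]. In the new [T] the sum
    of [g u v] over the edges [uv] appears; it is known from the equation that
    defines [g] ([sum_green_edges], in essence Foster's theorem), which is where
    the number of nodes enters. *)

(** * The Laplacian *)

Section Laplacian.
Variables (R : realFieldType) (G : sgraph).
Implicit Types (x y : G) (v w : G -> R).

Definition laplacian v x : R := \sum_(y | adj x y) (v x - v y).

Lemma laplacianD v w x :
  laplacian (fun z => v z + w z) x = laplacian v x + laplacian w x.
Proof. by rewrite -big_split; apply: eq_bigr => y _ /=; ring. Qed.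

Lemma laplacianB v w x :
  laplacian (fun z => v z - w z) x = laplacian v x - laplacian w x.
Proof. by rewrite -sumrB; apply: eq_bigr => y _; ring. Qed.

Lemma laplacianZ a v x : laplacian (fun z => a * v z) x = a * laplacian v x.
Proof. by rewrite mulr_sumr; apply: eq_bigr => y _; ring. Qed.

Lemma laplacian_sum (I : finType) (P : pred I) (F : I -> G -> R) x :
  laplacian (fun z => \sum_(i | P i) F i z) x =
  \sum_(i | P i) laplacian (F i) x.
Proof.
by rewrite [RHS]exchange_big; apply: eq_bigr => y _; rewrite -sumrB.
Qed.

Lemma natr_degree x : (degree x)%:R = \sum_(y | adj x y) 1 :> R.
Proof.
rewrite /degree -sum1_card natr_sum.
by apply: eq_bigl => y; rewrite inE.
Qed.

Lemma laplacianE v x :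
  laplacian v x = (degree x)%:R * v x - \sum_(y | adj x y) v y.
Proof.
by rewrite /laplacian sumrB natr_degree mulr_suml; under [in RHS]eq_bigr do rewrite mul1r.
Qed.

(** Each edge contributes opposite currents at its two ends. *)
Lemma sum_laplacian v : \sum_x laplacian v x = 0.
Proof.
under eq_bigr do rewrite /laplacian sumrB.
rewrite sumrB; apply/eqP; rewrite subr_eq0; apply/eqP.
rewrite [RHS](exchange_big_dep xpredT) //=; apply: eq_bigr => x _.
by apply: eq_bigl => y; rewrite adj_sym.
Qed.

(** Maximum principle: where [v] is maximal all the differences with the
    neighbours are nonnegative, so they vanish, and the set of maximal points
    is closed under adjacency. *)
Lemma harmonic_constant v : connected_graph G ->
  (forall x, laplacian v x = 0) -> forall x y, v x = v y.
Proof.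
move=> Gconn v0.
suff [c cP] : exists c, forall x, x \in G -> v x = c.
  by move=> x y; rewrite !cP.
case: (pickP G) => [x0 _|G0]; last by exists 0 => x _; have := G0 x.
have [z _ argmaxz] := arg_maxP v (erefl : xpredT x0).
have zmax y : v y <= v z by exact: argmaxz.
exists (v z) => x _.
have max_closed : closed (@adj G) [pred x | v x == v z].
  apply: intro_closed; first exact/sym_connect_sym/adj_sym.
  move=> a b ab; rewrite !inE => /eqP va.
  have ge0 y : adj a y -> 0 <= v a - v y by rewrite va subr_ge0 zmax.
  by rewrite eq_sym -subr_eq0 -va (psumr_eq0P ge0 (v0 a) ab).
by have := closed_connect max_closed (Gconn z x); rewrite !inE eqxx => /esym/eqP.
Qed.

End Laplacian.

(** * Green kernels *)

Section GreenKernel.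
Variables (R : realFieldType) (G : sgraph).

(** The density [mu] is left free, which generalizes the pseudo-inverse of the
    Laplacian, where it is uniform: in the natural kernel of the triangulation no
    current leaves at middle nodes. *)
Definition green_kernel (g : G -> G -> R) (mu : G -> R) : Prop :=
  (forall x y, g x y = g y x) /\
  (forall x j, laplacian (g^~ j) x = (x == j)%:R - mu x).

(** The potential [g^~ i - g^~ j] solves the current law, and any other
    solution differs from it by a harmonic, hence constant, function. *)
Lemma resistance_green g mu : connected_graph G -> green_kernel g mu ->
  forall i j, resistance R i j = g i i + g j j - 2 * g i j.
Proof.
move=> Gconn [gsym gL] i j.
pose v z := g z i - g z j.
have vP : unit_current_potential i j v.
  by move=> x; rewrite -/(laplacian v x) laplacianB !gL; ring.
rewrite /resistance; case: xgetP => [r _ [w wP <-]|/(_ (v i - v j))[]]; last first.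
  by exists v.
have wv : laplacian (fun z => w z - v z) =1 fun=> 0.
  by move=> x; rewrite laplacianB /laplacian wP vP subrr.
have := harmonic_constant Gconn wv i j; rewrite /v => E.
have -> : w i = w j + (g i i - g i j) - (g j i - g j j).
  apply/eqP; rewrite -subr_eq0; move/eqP: E; rewrite -subr_eq0 => /eqP <-.
  by apply/eqP; ring.
by rewrite (gsym j i); ring.
Qed.

(** All the unit current that enters must leave, as no current is lost in the
    edges. *)
Lemma green_mass g mu (x : G) : green_kernel g mu -> \sum_y mu y = 1.
Proof.
move=> [_ gL]; have := sum_laplacian (g^~ x).
under eq_bigr do rewrite gL.
rewrite sumrB => /eqP.
rewrite (bigD1 x) //= eqxx big1 => [|y /negPf->//].
by rewrite addr0 subr_eq0 => /eqP.
Qed.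

(** The Laplacian matrix plus the all-ones matrix is invertible, because the
    kernel of the Laplacian consists of the constants, on which the all-ones
    matrix is injective. The inverse is a Green kernel whose current leaves
    uniformly. *)
Lemma ex_green_kernel : connected_graph G -> exists g mu, green_kernel g mu.
Proof.
move=> Gconn.
pose e (x y : G) : R := (x == y)%:R * (degree x)%:R - (adj x y)%:R + 1.
have esym x y : e x y = e y x.
  by rewrite /e adj_sym (eq_sym y); case: eqP => [->|_] //; rewrite !mul0r.
have eL (w : G -> R) x : \sum_y e x y * w y = laplacian w x + \sum_y w y.
  rewrite laplacianE [X in _ - X]big_mkcond.
  under [LHS]eq_bigr => y _ do rewrite /e mulrDl mulrBl mul1r.
  rewrite big_split sumrB /=; congr (_ - _ + _).
    rewrite (bigD1 x) //= eqxx mul1r big1 ?addr0 // => y.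
    by rewrite eq_sym => /negPf->; rewrite !mul0r.
  by apply: eq_bigr => y _; case: adj; rewrite ?mul1r ?mul0r.
have sum_ord (F : G -> R) : \sum_y F y = \sum_(i < #|G|) F (enum_val i).
  by apply: reindex; exact/onW_bij/enum_val_bij.
pose M : 'M[R]_#|G| := \matrix_(i, j) e (enum_val i) (enum_val j).
have Msym : M^T = M by apply/matrixP => i j; rewrite !mxE esym.
have Mu : M \in unitmx.
  rewrite unitmxE unitfE; apply/det0P => -[v /negP v0 vM]; apply: v0.
  (* A vector killed by the matrix is harmonic with sum 0, so it is 0. *)
  pose w (x : G) := v 0 (enum_rank x).
  have w0 x : laplacian w x + \sum_y w y = 0.
    have /rowP/(_ (enum_rank x)) := vM; rewrite !mxE => vMx.
    rewrite -eL -[RHS]vMx sum_ord.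
    apply: eq_bigr => i _.
    by rewrite mxE /w enum_valK enum_rankK esym mulrC.
  have sw0 (x : G) : \sum_y w y = 0.
    have : \sum_x (laplacian w x + \sum_y w y) = 0 by apply: big1.
    rewrite big_split /= sum_laplacian add0r sumr_const => /eqP.
    by rewrite mulrn_eq0 => /orP[/eqP/card0_eq/(_ x)//|/eqP].
  have wc x y : w x = w y.
    by apply: harmonic_constant => // z; rewrite -[LHS]addr0 -{1}(sw0 z) w0.
  apply/eqP/rowP => i; rewrite mxE -(enum_valK i) -/(w _).
  have := sw0 (enum_val i); under eq_bigr do rewrite (wc _ (enum_val i)).
  rewrite sumr_const => /eqP.
  by rewrite mulrn_eq0 => /orP[/eqP/card0_eq/(_ (enum_val i))//|/eqP].
pose g (x y : G) := invmx M (enum_rank x) (enum_rank y).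
have gsym x y : g x y = g y x by rewrite /g -{1}Msym -trmx_inv mxE.
have gE x j : laplacian (g^~ j) x + \sum_y g y j = (x == j)%:R.
  have /matrixP/(_ (enum_rank x) (enum_rank j)) := mulmxV Mu.
  rewrite !mxE (inj_eq enum_rank_inj) => <-.
  rewrite -eL sum_ord.
  by apply: eq_bigr => i _; rewrite mxE /g enum_valK enum_rankK.
have gsum j : \sum_y g y j = #|G|%:R^-1.
  have : \sum_x (laplacian (g^~ j) x + \sum_y g y j) = 1.
    under eq_bigr do rewrite gE.
    by rewrite (bigD1 j) //= eqxx big1 ?addr0 // => y /negPf->.
  rewrite big_split /= sum_laplacian add0r sumr_const => sumE.
  have n0 : #|G|%:R != 0 :> R.
    by rewrite pnatr_eq0; apply/eqP => /card0_eq/(_ j).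
  by apply: (mulIf n0); rewrite mulVf // mulr_natr.
exists g, (fun=> #|G|%:R^-1); split=> // x j.
by rewrite -gE gsum addrK.
Qed.

Lemma mult_degree_kirchhoff_green g mu :
  connected_graph G -> green_kernel g mu ->
  mult_degree_kirchhoff R G =
    (\sum_(x : G) (degree x)%:R) * (\sum_x (degree x)%:R * g x x) -
    \sum_x \sum_y (degree x)%:R * (degree y)%:R * g x y.
Proof.
move=> Gconn gP; rewrite /mult_degree_kirchhoff.
under eq_bigr do under eq_bigr do rewrite (resistance_green Gconn gP).
set D := \sum_x _; set T := \sum_x _ * g _ _; set Q := \sum_x _.
have -> : \sum_(i : G) \sum_j (degree i)%:R * (degree j)%:R *
    (g i i + g j j - 2 * g i j) = D * T + D * T - 2 * Q.
  transitivity (\sum_(i : G) ((degree i)%:R * g i i * D + (degree i)%:R * T -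
                   2 * \sum_j (degree i)%:R * (degree j)%:R * g i j)).
    apply: eq_bigr => i _; rewrite !mulr_sumr -big_split -sumrB /=.
    by apply: eq_bigr => j _; ring.
  rewrite sumrB big_split /= -!mulr_suml -mulr_sumr -/D -/T -/Q.
  by ring.
by field.
Qed.

End GreenKernel.

(** * Sums over edges *)

Section Edges.
Variable G : sgraph.
Implicit Types (u v : G) (A : {set G}).

Lemma edgesP A :
  reflect (exists u v, adj u v /\ A = [set u; v]%SET) (A \in edges G).
Proof.
rewrite inE; apply: (iffP existsP) => [[u /existsP[v /andP[uv /eqP->]]]|].
  by exists u, v.
by move=> [u [v [uv ->]]]; exists u; apply/existsP; exists v; rewrite uv eqxx.
Qed.

Lemma adj_neq u v : adj u v -> u != v.
Proof. by apply: contraTneq => ->; rewrite adj_irrefl. Qed.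

Variable R : realFieldType.

Lemma sum_set2 u v (F : G -> R) :
  adj u v -> \sum_(w in [set u; v]%SET) F w = F u + F v.
Proof. by move=> uv; rewrite big_setU1 ?big_set1 // inE adj_neq. Qed.

Lemma sum_edge1 A : A \in edges G -> \sum_(u in A) 1 = 2 :> R.
Proof. by case/edgesP=> u [v [uv ->]]; rewrite sum_set2. Qed.

Lemma sum_incident_edges u (F : {set G} -> R) :
  \sum_(A in edges G | u \in A) F A = \sum_(v | adj u v) F [set u; v]%SET.
Proof.
rewrite -(big_imset (h := fun v => [set u; v]%SET) (A := adj u) F).
  apply: eq_bigl => A; apply/andP/imsetP => [[/edgesP[x [y [xy ->]]]]|].
    rewrite !inE => /orP[]/eqP->; first by exists y.
    by exists x; [move: xy; rewrite adj_sym | rewrite finset.setUC].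
  move=> [v uv ->]; split; last by rewrite !inE eqxx.
  by apply/edgesP; exists u, v.
move=> v w; rewrite !unfold_in => uv uw /setP/(_ v).
by rewrite !inE eqxx orbT eq_sym (negPf (adj_neq uv)) /= => /esym/eqP.
Qed.

(** Double counting of the incidences between nodes and edges. *)
Lemma sum_incidences (F : {set G} -> G -> R) :
  \sum_(A in edges G) \sum_(u in A) F A u =
  \sum_u \sum_(v | adj u v) F [set u; v]%SET u.
Proof.
rewrite (exchange_big_dep xpredT) //=; apply: eq_bigr => u _.
exact: (sum_incident_edges u (F^~ u)).
Qed.

Lemma sum_edge_ends (h : G -> R) :
  \sum_(A in edges G) \sum_(u in A) h u = \sum_u (degree u)%:R * h u.
Proof.
rewrite (sum_incidences (fun=> h)); apply: eq_bigr => u _.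
by rewrite natr_degree mulr_suml; apply: eq_bigr => v _; rewrite mul1r.
Qed.

Lemma sum_degrees : \sum_(u : G) (degree u)%:R = 2 * #|edges G|%:R :> R.
Proof.
have := sum_edge_ends (fun=> 1); under [RHS]eq_bigr do rewrite mulr1.
move=> <-; under eq_bigr => A eA do rewrite sum_edge1 //.
by rewrite sumr_const mulr_natr.
Qed.

(** The sum of [g u v] over the edges [uv] reduces to the diagonal, since the
    equation defining a Green kernel at [j = u] gives the sum of [g u v] over
    the neighbours [v] of [u]. In terms of resistances this is Foster's theorem:
    over the edges of a nonempty connected graph they add up to [#|G| - 1]. *)
Lemma sum_green_edges (g : G -> G -> R) mu : green_kernel g mu ->
  \sum_(A in edges G) \sum_(u in A) \sum_(v in A) g u v =
  2 * (\sum_u (degree u)%:R * g u u) - #|G|%:R + \sum_u mu u.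
Proof.
move=> [gsym gL]; rewrite (sum_incidences (fun A u => \sum_(v in A) g u v)).
transitivity (\sum_(u : G) (2 * ((degree u)%:R * g u u) - 1 + mu u)).
  apply: eq_bigr => u _.
  under eq_bigr => v uv do rewrite sum_set2 //.
  have := gL u u; rewrite laplacianE eqxx mulr1n => /eqP.
  rewrite subr_eq => /eqP E.
  rewrite big_split /=.
  under [X in _ + X]eq_bigr do rewrite gsym.
  have -> : \sum_(v | adj u v) g u u = (degree u)%:R * g u u.
    by rewrite natr_degree mulr_suml; apply: eq_bigr => v _; rewrite mul1r.
  by rewrite E; ring.
by rewrite big_split sumrB -mulr_sumr /= sumr_const.
Qed.

End Edges.

(** * The triangulation graph *)

Section Triangulation.
Variables (R : realFieldType) (G : sgraph) (q : nat).
Local Notation TG := (triangulation q G).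
Local Notation edge := {A : {set G} | A \in edges G}.
Implicit Types (a b : TG) (u v w : G) (h : G -> R) (F : TG -> R) (e : edge).

Definition old u : TG := inl u.
Definition new e (k : 'I_q) : TG := inr (e, k).

Lemma sum_tri F :
  \sum_a F a = \sum_u F (old u) + \sum_(e : edge) \sum_k F (new e k).
Proof. by rewrite big_sumType pair_bigA; congr (_ + _); apply: eq_bigr => -[]. Qed.

Lemma sum_neighbours_old u F :
  \sum_(b | adj (old u) b) F b =
  \sum_(v | adj u v) F (old v) +
  \sum_(e : edge | u \in val e) \sum_k F (new e k).
Proof.
rewrite big_sumType; congr (_ + _).
rewrite pair_big_dep /=.
by apply: eq_big => [[e k]|[e k] _]; rewrite ?andbT.
Qed.

Lemma sum_neighbours_new e k F :
  \sum_(b | adj (new e k) b) F b = \sum_(u in val e) F (old u).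
Proof. by rewrite big_sumType /= addrC big1 ?add0r // => -[]. Qed.

Lemma sum_incident_middles u (f : {set G} -> R) :
  \sum_(e : edge | u \in val e) \sum_(k < q) f (val e) =
  q%:R * \sum_(v | adj u v) f [set u; v]%SET.
Proof.
rewrite -sum_incident_edges big_sub_cond mulr_sumr.
by apply: eq_bigr => e _; rewrite sumr_const card_ord mulr_natl.
Qed.

Lemma sum_middles (f : {set G} -> R) :
  \sum_(e : edge) \sum_(k < q) f (val e) = q%:R * \sum_(A in edges G) f A.
Proof.
rewrite [X in _ * X]big_sub mulr_sumr.
by apply: eq_bigr => e _; rewrite sumr_const card_ord mulr_natl.
Qed.

Lemma degree_old u : (degree (old u))%:R = (q%:R + 1) * (degree u)%:R :> R.
Proof.
rewrite !natr_degree sum_neighbours_old (sum_incident_middles u (fun=> 1)).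
by ring.
Qed.

Lemma degree_new e k : (degree (new e k))%:R = 2 :> R.
Proof. by rewrite natr_degree sum_neighbours_new sum_edge1 ?(valP e). Qed.

(** Extends a potential on the nodes of [G] to the middle nodes by the current
    law: no current leaves a middle node. *)
Definition endpoint_mean h a : R :=
  match a with
  | inl u => h u
  | inr (e, _) => 2^-1 * \sum_(u in val e) h u
  end.

Lemma endpoint_mean_const c a : endpoint_mean (fun=> c) a = c.
Proof.
case: a => [//|[e k]] /=.
rewrite (eq_bigr (fun=> 1 * c)) => [|u _]; last by rewrite mul1r.
by rewrite -mulr_suml sum_edge1 ?(valP e) //; field.
Qed.

Lemma endpoint_meanB h h' a :
  endpoint_mean (fun u => h u - h' u) a = endpoint_mean h a - endpoint_mean h' a.
Proof. by case: a => [//|[e k]] /=; rewrite sumrB mulrBr. Qed.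

Lemma endpoint_mean_sum (I : finType) (F : I -> G -> R) (c : I -> R) a :
  endpoint_mean (fun u => \sum_i c i * F i u) a =
  \sum_i c i * endpoint_mean (F i) a.
Proof.
case: a => [//|[e k]] /=; rewrite exchange_big mulr_sumr.
by apply: eq_bigr => i _; rewrite -mulr_sumr mulrCA.
Qed.

Lemma eq_endpoint_mean h h' : h =1 h' -> endpoint_mean h =1 endpoint_mean h'.
Proof. by move=> hh' [u|[e k]] //=; under eq_bigr do rewrite hh'. Qed.

Lemma endpoint_meanC (g : G -> G -> R) a b :
  endpoint_mean (fun u => endpoint_mean (g u) b) a =
  endpoint_mean (fun v => endpoint_mean (g^~ v) a) b.
Proof.
case: a b => [u|[e k]] [v|[f l]] //=.
by rewrite -!mulr_sumr exchange_big.
Qed.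

Lemma laplacian_endpoint_mean (g : G -> G -> R) b u :
  laplacian (fun v => endpoint_mean (g v) b) u =
  endpoint_mean (fun j => laplacian (g^~ j) u) b.
Proof. by case: b => [//|[e k]] /=; rewrite laplacianZ laplacian_sum. Qed.

(** The [q] paths of length 2 added to an edge act as [q] parallel resistors
    of resistance 2, so its conductance becomes [1 + q / 2]. *)
Lemma laplacian_mean_old h u :
  laplacian (endpoint_mean h) (old u) = (q%:R + 2) / 2 * laplacian h u.
Proof.
rewrite /laplacian sum_neighbours_old /=.
rewrite (sum_incident_middles u (fun A => h u - 2^-1 * \sum_(v in A) h v)).
have -> : \sum_(v | adj u v) (h u - 2^-1 * \sum_(w in [set u; v]%SET) h w) =
          \sum_(v | adj u v) 2^-1 * (h u - h v).
  by apply: eq_bigr => v uv; rewrite sum_set2 //; field.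
by rewrite -mulr_sumr; field.
Qed.

Lemma laplacian_mean_new h e k : laplacian (endpoint_mean h) (new e k) = 0.
Proof.
rewrite laplacianE degree_new sum_neighbours_new /=.
by field.
Qed.

(** For a middle node [b], the potential of a unit current that enters at [b]
    while all the old nodes are held at 0: two unit resistors in parallel. For an
    old node [b], it vanishes. *)
Definition local_green a b : R := if a is inr _ then 2^-1 * (a == b)%:R else 0.

Lemma laplacian_local_old u b :
  laplacian (local_green^~ b) (old u) =
  (if b is inl _ then 0 else - endpoint_mean (fun v => (u == v)%:R) b).
Proof.
rewrite laplacianE mulr0 sub0r sum_neighbours_old big1 ?add0r //.
case: b => [v|[e k]] /=.
  by rewrite big1 ?oppr0 // => f _; rewrite big1 // => l _; rewrite mulr0.
congr (- _); rewrite pair_big_dep /=.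
have -> : \sum_(v in val e) (u == v)%:R = (u \in val e)%:R :> R.
  have [ue|une] := boolP (u \in val e).
    rewrite (bigD1 u) //= eqxx big1 ?addr0 // => v /andP[_].
    by rewrite eq_sym => /negPf->.
  by rewrite big1 // => v ve; case: eqP une => // ->; rewrite ve.
have off (p : edge * 'I_q) : p != (e, k) -> local_green (inr p) (inr (e, k)) = 0.
  by move=> /negPf pek; rewrite /= -[_ == _]/(p == (e, k)) pek mulr0.
have [ue|une] := boolP (u \in val e).
  rewrite (bigD1 (e, k)) /= ?ue // eqxx big1 ?addr0 // => p /andP[_].
  by case: p => f l; exact: off.
rewrite mulr0 big1 // => -[f l] /= uf; apply: off.
by apply: contraNneq une => -[<- _]; case/andP: uf.
Qed.

Lemma laplacian_local_new e k b :
  laplacian (local_green^~ b) (new e k) = (new e k == b)%:R.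
Proof.
rewrite laplacianE degree_new sum_neighbours_new big1 // subr0 /=.
by field.
Qed.

(** A unit current entering at a middle node [b] first flows half to each
    endpoint, with local response [local_green^~ b]; between old nodes the
    currents then see [G] with all conductances multiplied by
    [(q + 2) / 2]. *)
Definition triangulation_green (g : G -> G -> R) a b : R :=
  2 / (q%:R + 2) * endpoint_mean (fun u => endpoint_mean (g u) b) a +
  local_green a b.

Definition old_mass (mu : G -> R) a : R := if a is inl u then mu u else 0.

Lemma qD2_neq0 : q%:R + 2 != 0 :> R.
Proof. by rewrite -natrD pnatr_eq0 addn2. Qed.

(** The local response sends into the endpoints of a middle node [b] the currents
    that the first term of the kernel takes as sources, so at old nodes the
    contributions of [b] cancel and only [mu] remains. *)
Lemma triangulation_greenP g mu : green_kernel g mu ->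
  green_kernel (triangulation_green g) (old_mass mu).
Proof.
move=> [gsym gL]; split=> [a b|a b].
  rewrite /triangulation_green endpoint_meanC; congr (_ * _ + _).
    by do 2!apply: eq_endpoint_mean => ?.
  case: a b => [u|[e k]] [v|[f l]] //=; first by rewrite mulr0.
    by rewrite mulr0.
  by rewrite eq_sym.
rewrite laplacianD laplacianZ.
case: a => [u|[e k]]; last first.
  by rewrite laplacian_mean_new laplacian_local_new mulr0 add0r subr0.
rewrite laplacian_mean_old laplacian_local_old mulrA.
have -> : 2 / (q%:R + 2) * ((q%:R + 2) / 2) = 1 :> R.
  by field; rewrite qD2_neq0.
rewrite mul1r laplacian_endpoint_mean.
rewrite (eq_endpoint_mean (gL u)) endpoint_meanB endpoint_mean_const.
case: b => [v|p]; first by rewrite addr0.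
by rewrite addrAC subrr.
Qed.

Lemma triangulation_connected : connected_graph G -> connected_graph TG.
Proof.
move=> Gconn.
have csym : connect_sym (@adj TG) by exact/sym_connect_sym/adj_sym.
have old_old u v : connect (@adj TG) (old u) (old v).
  have reach_closed : closed (@adj G) [pred w | connect (@adj TG) (old u) (old w)].
    apply: intro_closed; first exact/sym_connect_sym/adj_sym.
    move=> w x wx; rewrite !inE => uw; apply: connect_trans uw _.
    exact: connect1.
  by have := closed_connect reach_closed (Gconn u v); rewrite !inE connect0.
have to_old a : exists u, connect (@adj TG) a (old u).
  case: a => [u|[e k]]; first by exists u.
  have /edgesP[u [v [_ eE]]] := valP e; exists u; apply: connect1 => /=.
  by rewrite eE !inE eqxx.
move=> a b; have [[u au] [v bv]] := (to_old a, to_old b).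
apply: connect_trans au (connect_trans (old_old u v) _).
by rewrite csym.
Qed.

(** Each old node [u] of degree [d u] keeps the weight [(q + 1) * d u], and gets
    [1] from each of the [q * d u] middle nodes adjacent to it. *)
Lemma sum_degree_mean h :
  \sum_(a : TG) (degree a)%:R * endpoint_mean h a =
  (2 * q%:R + 1) * \sum_(u : G) (degree u)%:R * h u.
Proof.
rewrite sum_tri /=.
under eq_bigr do rewrite degree_old -mulrA.
under [X in _ + X]eq_bigr do under eq_bigr do rewrite degree_new.
rewrite (sum_middles (fun A => 2 * (2^-1 * \sum_(u in A) h u))).
have -> : \sum_(A in edges G) 2 * (2^-1 * \sum_(u in A) h u) =
          \sum_u (degree u)%:R * h u.
  by rewrite -sum_edge_ends; apply: eq_bigr => A _; field.
by rewrite -mulr_sumr; ring.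
Qed.

Lemma sum_degrees_tri :
  \sum_(a : TG) (degree a)%:R = (2 * q%:R + 1) * \sum_(u : G) (degree u)%:R :> R.
Proof.
have := sum_degree_mean (fun=> 1).
under eq_bigr do rewrite endpoint_mean_const mulr1.
by under [X in _ * X]eq_bigr do rewrite mulr1.
Qed.

(** At a middle node of [uv], the diagonal value of the kernel involves the mean
    of [g] over the four pairs of endpoints, hence [sum_green_edges]. *)
Lemma sum_green_diag_tri g mu : green_kernel g mu ->
  \sum_(a : TG) (degree a)%:R * triangulation_green g a a =
  2 / (q%:R + 2) * ((2 * q%:R + 1) * (\sum_u (degree u)%:R * g u u)
     + q%:R / 2 * (\sum_u mu u - #|G|%:R)) + q%:R * #|edges G|%:R.
Proof.
move=> gP; rewrite sum_tri.
under eq_bigr do rewrite degree_old /triangulation_green /= addr0.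
under [X in _ + X]eq_bigr do under eq_bigr do
  rewrite degree_new /triangulation_green /= eqxx -mulr_sumr.
rewrite (sum_middles (fun A => 2 * (2 / (q%:R + 2) * (2^-1 *
    (2^-1 * \sum_(u in A) \sum_(v in A) g u v)) + 2^-1 * 1))).
have -> : \sum_(A in edges G) 2 * (2 / (q%:R + 2) * (2^-1 *
    (2^-1 * \sum_(u in A) \sum_(v in A) g u v)) + 2^-1 * 1) =
  \sum_(A in edges G) ((q%:R + 2)^-1 * (\sum_(u in A) \sum_(v in A) g u v) + 1).
  by apply: eq_bigr => A _; field; rewrite qD2_neq0.
rewrite big_split /= -mulr_sumr (sum_green_edges gP) sumr_const.
have -> : \sum_(u : G) (q%:R + 1) * (degree u)%:R * (2 / (q%:R + 2) * g u u) =
    (q%:R + 1) * (2 / (q%:R + 2)) * \sum_u (degree u)%:R * g u u.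
  by rewrite mulr_sumr; apply: eq_bigr => u _; ring.
by field; rewrite qD2_neq0.
Qed.

Lemma sum_green_tri g :
  \sum_(a : TG) \sum_(b : TG) (degree a)%:R * (degree b)%:R * triangulation_green g a b =
  2 / (q%:R + 2) * (2 * q%:R + 1) ^+ 2 *
    (\sum_u \sum_v (degree u)%:R * (degree v)%:R * g u v)
  + 2 * q%:R * #|edges G|%:R.
Proof.
pose d a : R := (degree a)%:R.
transitivity (\sum_a (2 / (q%:R + 2) * (d a * endpoint_mean
   (fun u => \sum_b d b * endpoint_mean (g u) b) a) + d a ^+ 2 * local_green a a)).
  apply: eq_bigr => a _; rewrite endpoint_mean_sum.
  have -> : d a ^+ 2 * local_green a a = \sum_b d a * d b * local_green a b.
    rewrite (bigD1 a) //= big1 => [|b]; first by ring.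
    case: (a) => [u|p] /=; rewrite ?mulr0 // eq_sym => /negPf->.
    by rewrite !mulr0.
  rewrite mulrA mulr_sumr -big_split /=; apply: eq_bigr => b _.
  by rewrite /triangulation_green /d; ring.
rewrite big_split -mulr_sumr sum_degree_mean /=; congr (_ + _).
  under [X in _ * (_ * X)]eq_bigr do rewrite sum_degree_mean mulrCA mulr_sumr.
  rewrite -mulr_sumr.
  under [X in _ * (_ * (_ * X))]eq_bigr do under eq_bigr do rewrite mulrA.
  by ring.
rewrite sum_tri big1 => [|u _]; last by rewrite mulr0.
under eq_bigr do under eq_bigr do rewrite /d degree_new /= eqxx.
rewrite (sum_middles (fun=> 2 ^+ 2 * (2^-1 * 1))) sumr_const.
by field.
Qed.

End Triangulation.

Theorem theorem6 (R : realFieldType) (G : sgraph) (n m q : nat)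
    (G_conn : connected_graph G)
    (G_nodes : #|G| = n) (G_edges : #|edges G| = m) (q_gt0 : (0 < q)%N) :
  mult_degree_kirchhoff R (triangulation q G) =
    2 * (2 * q%:R + 1) ^+ 2 / (q%:R + 2) * mult_degree_kirchhoff R G
    + 2 * m%:R *
      ((q%:R ^+ 2 + (4 * n%:R - 1) * q%:R + 2 * n%:R) / (q%:R + 2)
       + (m%:R * q%:R - n%:R) * (2 * q%:R + 1)).
Proof.
have [g [mu gP]] := ex_green_kernel R G_conn.
rewrite (mult_degree_kirchhoff_green G_conn gP).
rewrite (mult_degree_kirchhoff_green (triangulation_connected (q := q) G_conn)
  (triangulation_greenP q gP)).
rewrite sum_degrees_tri (sum_green_diag_tri q gP) sum_green_tri.
(* The edgeless case is separate because [mu] has sum 0 when [G] is empty. *)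
have mass : m%:R * (\sum_u mu u) = m%:R :> R.
  case: (posnP m) => [->|m_gt0]; first by rewrite mul0r.
  have /card_gt0P[A /edgesP[x _]] : (0 < #|edges G|)%N by rewrite G_edges.
  by rewrite (green_mass x gP) mulr1.
rewrite sum_degrees G_nodes G_edges.
set T := \sum_x _ * g _ _; set Q := \sum_x \sum_y _; set s := \sum_u mu u in mass *.
rewrite [X in X - _](_ : _ = (2 * q%:R + 1) * (2 / (q%:R + 2) * (2 * m%:R *
  ((2 * q%:R + 1) * T - q%:R / 2 * n%:R) + q%:R * (m%:R * s)) +
  2 * m%:R * (q%:R * m%:R))); last by field; rewrite qD2_neq0.
by rewrite mass; field; rewrite qD2_neq0.
Qed.
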